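(* Let $K>1$, $\mathcal{Y}=\{1,\dots,K\}$, $(X,Y,M)$ distributed on $\mathcal{X}\times\mathcal{Y}\times\mathcal{Y}$, and let $\bm{g}:\mathcal{X}\to\mathbb{R}^{K+1}$ be measurable with classifier part $\bm{g}_{\rm class}=(g_1,\dots,g_K)$. Then $$\max\Big(R_{01}(\bm{g}_{\rm class})-R_{01}^*,\ R^{\bot}_{01}(\bm{g})-R^{\bot*}_{01}\Big)\le\sqrt{2\big(R_{L_{\tilde{\psi}}}(\bm{g})-R^*_{L_{\tilde{\psi}}}\big)}.$$
   Context: Asymmetric softmax: $\tilde{\psi}_y(\bm{u})=\exp(u_y)/\sum_{y'=1}^K\exp(u_{y'})$ for $y\le K$, $\tilde{\psi}_{K+1}(\bm{u})=\exp(u_{K+1})/(\sum_{y'=1}^{K+1}\exp(u_{y'})-\max_{y'\le K}\exp(u_{y'}))$. Surrogate $L_{\tilde{\psi}}(\bm{u},y,m)=-\log\tilde{\psi}_y(\bm{u})-[\![m\ne y]\!]\log(1-\tilde{\psi}_{K+1}(\bm{u}))-[\![m=y]\!]\log\tilde{\psi}_{K+1}(\bm{u})$, $R_{L_{\tilde{\psi}}}(\bm{g})=\mathbb{E}[L_{\tilde{\psi}}(\bm{g}(X),Y,M)]$ and $R^*_{L_{\tilde{\psi}}}$ its infimum over measurable $\bm{g}$. $R_{01}(\bm{g}_{\rm class})=\Pr(\mathop{\rm argmax}_{y\le K}g_y(X)\ne Y)$ and $R^*_{01}$ is the Bayes (minimal) misclassification error. The 0-1-deferral loss is $\ell^{\bot}_{01}(f(\bm{x}),y,m)=[\![f(\bm{x})\in\mathcal{Y},\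 f(\bm{x})\ne y]\!]+[\![f(\bm{x})=\bot,\ m\ne y]\!]$; $R^{\bot}_{01}(\bm{g})=\mathbb{E}[\ell^{\bot}_{01}(\varphi(\bm{g}(X)),Y,M)]$ where $\varphi(\bm{u})=\bot$ if $u_{K+1}>\max_{y\le K}u_y$ and $\varphi(\bm{u})=\mathop{\rm argmax}_{y\le K}u_y$ otherwise; $R^{\bot*}_{01}$ is the infimum of the 0-1-deferral risk over all $f:\mathcal{X}\to\mathcal{Y}\cup\{\bot\}$. *)

(* Defs.v *)
From HB Require Import structures.
From mathcomp Require Import all_boot all_order all_algebra.
From mathcomp Require Import all_classical all_reals all_analysis.
Set Implicit Arguments. Unset Strict Implicit. Unset Printing Implicit Defensive.
Import Order.TTheory GRing.Theory Num.Theory.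
Import numFieldNormedType.Exports.
Local Open Scope classical_set_scope.
Local Open Scope ring_scope.

Section Defs.
Context {R : realType}.
Context {K : nat}.

(* Score vectors u in R^{K+1} are functions 'I_K.+1 -> R.
   Class y in {1..K} is the ordinal y : 'I_K, embedded as [cls y];
   the deferral coordinate K+1 is ord_max. *)
Definition cls (y : 'I_K) : 'I_K.+1 := widen_ord (leqnSn K) y.
Definition dfr : 'I_K.+1 := ord_max.

Definition psi_cls (u : 'I_K.+1 -> R) (y : 'I_K) : R :=
  expR (u (cls y)) / \sum_(y' < K) expR (u (cls y')).
Definition psi_dfr (u : 'I_K.+1 -> R) : R :=
  expR (u dfr) / (\sum_(y' < K.+1) expR (u y')
                  - \big[Num.max/0]_(y' < K) expR (u (cls y'))).

Definition Lpsi (u : 'I_K.+1 -> R) (y m : 'I_K) : R :=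
  - ln (psi_cls u y)
  - (m != y)%:R * ln (1 - psi_dfr u)
  - (m == y)%:R * ln (psi_dfr u).

(* argmax over the K classes (ties broken by the first maximiser) *)
Definition argmax_cls (u : 'I_K.+1 -> R) : option 'I_K :=
  [pick i : 'I_K | [forall j : 'I_K, u (cls j) <= u (cls i)]].

(* the induced rule phi: None stands for the deferral option bot *)
Definition phi (u : 'I_K.+1 -> R) : option 'I_K :=
  if ((\big[Order.max/-oo]_(y < K) (u (cls y))%:E) < (u dfr)%:E)%E
  then None else argmax_cls u.

(* 0-1-deferral loss; the prediction f(x) is in option 'I_K, None = bot *)
Definition loss01_defer (fx : option 'I_K) (y m : 'I_K) : R :=
  match fx with
  | Some c => (c != y)%:R
  | None => (m != y)%:R
  end.
End Defs.

Section Risks.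
Local Open Scope ereal_scope.
Context {R : realType} {K : nat}.
Context {d : measure_display} {Omega : measurableType d}
  (P : probability Omega R).
Context {dX : measure_display} {Xs : measurableType dX}.
Variables (X : Omega -> Xs) (Y M : Omega -> 'I_K).

Definition measurable_scorer (g : 'I_K.+1 -> Xs -> R) : Prop :=
  forall i, measurable_fun setT (g i).

Definition measurable_finmap (T : finType) (f : Xs -> T) : Prop :=
  forall t : T, measurable (f @^-1` [set t]).

Definition risk_L (g : 'I_K.+1 -> Xs -> R) : \bar R :=
  \int[P]_w (Lpsi (fun i => g i (X w)) (Y w) (M w))%:E.

Definition risk_L_star : \bar R :=
  ereal_inf [set risk_L g | g in measurable_scorer].

Definition risk01 (g : 'I_K.+1 -> Xs -> R) : \bar R :=
  P [set w | argmax_cls (fun i => g i (X w)) != Some (Y w)].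

Definition risk01_star : \bar R :=
  ereal_inf [set P [set w | h (X w) != Y w] | h in @measurable_finmap _ ].

Definition risk01_defer_of (f : Xs -> option 'I_K) : \bar R :=
  \int[P]_w (loss01_defer (f (X w)) (Y w) (M w))%:E.

Definition risk01_defer (g : 'I_K.+1 -> Xs -> R) : \bar R :=
  risk01_defer_of (fun x => phi (fun i => g i x)).

Definition risk01_defer_star : \bar R :=
  ereal_inf [set risk01_defer_of f | f in @measurable_finmap _].
End Risks.

(* Main.v *)
Require Import Defs.
From HB Require Import structures.
From mathcomp Require Import all_boot all_order all_algebra.
From mathcomp Require Import all_classical all_reals all_analysis.
From mathcomp Require Import measurable_realfun.
From mathcomp Require Import ring lra.
Import Order.TTheory GRing.Theory Num.Theory.
Import numFieldNormedType.Exports.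
Local Open Scope classical_set_scope.
Local Open Scope ring_scope.

(** The surrogate is the log-loss of the class distribution [psi_cls] plus the
    log-loss of the coin [psi_dfr] that predicts whether [M = Y].
    Let [a] be the decision induced by [g] and [f] any competing decision rule;
    [a] has the larger score everywhere.  Tilt the two distributions of [g]
    exponentially, by a constant factor [lam], towards [f] and away from [a].
    The linear part of the loss then drops by [lam] times the difference of the
    0-1-deferral losses, while the log-partition functions grow by at most
    [ln (cosh lam) <= lam ^+ 2 / 2], because [a] has the larger score.
    Integrating, [R_L^* <= R_L(g) - lam * regret + lam ^+ 2 / 2], and [lam := regret]
    gives the bound.  This is the variational form of Pinsker's inequality; it
    needs neither conditional probabilities nor a minimizer of the surrogate. *)

(** * Real inequalities: bounds on [cosh] and on the growth of tilted partition functions *)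

Section Analysis.
Context {R : realType}.
Implicit Types x : R.

Lemma is_derive_ge0_le (f df : R -> R) (x : R) :
  (forall t : R, is_derive t (1 : R) f (df t)) -> (forall t, 0 < t -> 0 <= df t) ->
  0 <= x -> f 0 <= f x.
Proof.
move=> fdf df0 x0.
have dff t : derivable f t 1 by case: (fdf t).
apply: (@ger0_derive1_le_cc _ f 0 x) => //; rewrite ?in_itv/= ?lexx ?x0//.
- move=> t; rewrite in_itv/= => /andP[t0 _].
  by rewrite derive1E derive_val; exact: df0.
- apply: continuous_subspaceT => t.
  by apply/differentiable_continuous/derivable1_diffP.
Qed.

(** Twice [t cosh t - sinh t] vanishes at 0, and its derivative, twice [t sinh t], is nonnegative
    for positive [t]. *)
Lemma sinh_le_x_cosh x : 0 <= x ->
  expR x - expR (- x) <= x * (expR x + expR (- x)).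
Proof.
move=> x0; rewrite -subr_ge0.
pose f (t : R) := t * (expR t + expR (- t)) - (expR t - expR (- t)).
have -> : 0 = f 0 by rewrite /f mul0r oppr0 subrr subr0.
apply: (@is_derive_ge0_le f (fun t => t * (expR t - expR (- t)))) => //.
- move=> t; apply: is_derive_eq.
  by rewrite /GRing.scale/=; ring.
- move=> t t0; rewrite mulr_ge0 ?(ltW t0)// subr_ge0 ler_expR; lra.
Qed.

(** By the previous bound [exp(-t^2/2) cosh t] has nonpositive derivative for positive [t]; [f] is
    minus twice this function, so that the monotonicity criterion applies. *)
Lemma cosh_le_expR_half_sqr x : 0 <= x ->
  expR x + expR (- x) <= 2 * expR (x ^+ 2 / 2).
Proof.
move=> x0.
pose f (t : R) := - (expR (- (t ^+ 2 / 2)) * (expR t + expR (- t))).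
have : f 0 <= f x.
  apply: (@is_derive_ge0_le f (fun t => expR (- (t ^+ 2 / 2)) *
    (t * (expR t + expR (- t)) - (expR t - expR (- t))))) => //.
  - move=> t; apply: is_derive_eq.
    by rewrite /GRing.scale/=; field.
  - move=> t /ltW t0.
    by rewrite mulr_ge0 ?expR_ge0// subr_ge0 sinh_le_x_cosh.
rewrite /f lerN2 expr0n/= mul0r oppr0 expR0 mul1r.
by rewrite expRN ler_pdivrMl ?expR_gt0// mulrC.
Qed.

(* [E] and [E'] stand for [expR x] and [expR (- x)]. *)
Lemma tilt_two_outcomes (E E' p q : R) : E * E' = 1 -> 1 <= E -> 0 < E' ->
  0 <= p -> p <= q -> p + q <= 1 ->
  1 + p * (E - 1) + q * (E' - 1) <= (E + E') / 2.
Proof.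
move=> EE' E1 E'0 p0 pq pq1; have E'1 : E' <= 1 by nra.
have EE2 : 0 <= E + E' - 2 by nra.
(* The left side is [1 + p (E + E' - 2) + (q - p) (E' - 1)], and [p <= q] with [p + q <= 1] forces
   [p <= 1/2]. *)
have : (q - p) * (E' - 1) <= 0 by nra.
have : (2^-1 - p) * (E + E' - 2) >= 0 by rewrite mulr_ge0//; lra.
lra.
Qed.

(** The first factor grows with [p], so [p = q] is the worst case; there the product is
    [1 + (q - q^2) (E + E' - 2)], and [q - q^2 <= 1/2]. *)
Lemma tilt_two_coins (E E' p q : R) : E * E' = 1 -> 1 <= E -> 0 < E' ->
  0 <= p -> p <= q -> q <= 1 ->
  (1 + p * (E - 1)) * (1 + q * (E' - 1)) <= (E + E') / 2.
Proof.
move=> EE' E1 E'0 p0 pq q1; have E'1 : E' <= 1 by nra.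
apply: (@le_trans _ _ ((1 + q * (E - 1)) * (1 + q * (E' - 1)))).
  apply: ler_wpM2r; first by nra.
  by rewrite lerD2l ler_wpM2r// subr_ge0.
have -> : (1 + q * (E - 1)) * (1 + q * (E' - 1)) =
  1 + (q - q ^+ 2) * (E + E' - 2) + q ^+ 2 * (E * E' - 1) by ring.
rewrite EE' subrr mulr0 addr0.
have EE2 : 0 <= E + E' - 2 by nra.
have : (2^-1 - (q - q ^+ 2)) * (E + E' - 2) >= 0.
  by rewrite mulr_ge0// expr2; nra.
lra.
Qed.
End Analysis.

(** * Scores of decisions, and the surrogate as a sum of two log-losses *)

Section Scores.
Set Implicit Arguments.
Unset Strict Implicit.
Context {R : realType} {K : nat}.
Implicit Types (u : 'I_K.+1 -> R) (y m c : 'I_K) (a f : option 'I_K).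

Definition cls_sum u : R := \sum_(y < K) expR (u (cls y)).
Definition cls_max u : R := \big[Num.max/0]_(y < K) expR (u (cls y)).
(** The weight of all classes but one maximiser: what is added to [expR (u dfr)] in the denominator
    of [psi_dfr]. *)
Definition cls_rest u : R := cls_sum u - cls_max u.
(** The log-odds of [psi_dfr]. *)
Definition dfr_logit u : R := u dfr - ln (cls_rest u).

(** The class distribution and the coin are separate, so this is not a probability distribution over
    [option 'I_K]. *)
Definition score u a : R := if a is Some y then psi_cls u y else psi_dfr u.

Lemma cls_max_ge u y : expR (u (cls y)) <= cls_max u.
Proof. exact: le_bigmax. Qed.

Lemma cls_max_arg u c : (forall y, u (cls y) <= u (cls c)) ->
  cls_max u = expR (u (cls c)).
Proof.
move=> h; apply/eqP; rewrite eq_le cls_max_ge andbT.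
by apply: bigmax_le => [|y _]; rewrite ?expR_ge0// ler_expR.
Qed.

Lemma exists_argmax (hK : (0 < K)%N) u :
  exists c, forall y, u (cls y) <= u (cls c).
Proof.
have [c _ h] := @arg_maxP _ R _ (Ordinal hK) xpredT (fun y => u (cls y)) isT.
by exists c => y; exact: h.
Qed.

Lemma argmax_cls_Some (hK : (0 < K)%N) u :
  exists2 c, argmax_cls u = Some c & forall y, u (cls y) <= u (cls c).
Proof.
rewrite /argmax_cls; case: pickP => [c /forallP h|h]; first by exists c.
have [c hc] := exists_argmax hK u.
by move: (h c) => /negP[]; apply/forallP.
Qed.

Lemma phiE u : phi u =
  if [forall y, u (cls y) < u dfr] then None else argmax_cls u.
Proof.
rewrite /phi; congr (if _ then _ else _).
apply/idP/forallP => [h y|h].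
  by rewrite -lte_fin; apply: le_lt_trans h; exact: le_bigmax.
by apply/bigmax_ltP; split => [|y _]; rewrite ?ltNyr// lte_fin.
Qed.

(** Since [K > 1], removing one maximiser leaves another class with positive weight; this makes
    [dfr_logit] a genuine log-odds. *)
Lemma cls_rest_gt0 (hK : (1 < K)%N) u : 0 < cls_rest u.
Proof.
have [c hc] := exists_argmax (ltnW hK) u.
rewrite /cls_rest (cls_max_arg hc) /cls_sum (bigD1 c)//= addrAC subrr add0r.
have [y yc] : exists y, y != c.
  exists (if c == Ordinal hK then Ordinal (ltnW hK) else Ordinal hK).
  by case: ifPn => [/eqP ->|]; rewrite // eq_sym.
rewrite (bigD1 y)//= ltr_pwDl ?expR_gt0// sumr_ge0// => i _; exact: expR_ge0.
Qed.

Lemma expR_le_cls_sum u y : expR (u (cls y)) <= cls_sum u.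
Proof.
rewrite /cls_sum (bigD1 y)//= lerDl sumr_ge0// => i _; exact: expR_ge0.
Qed.

Lemma cls_sum_gt0 (hK : (1 < K)%N) u : 0 < cls_sum u.
Proof.
exact: lt_le_trans (expR_gt0 _) (expR_le_cls_sum u (Ordinal hK)).
Qed.

Lemma psi_dfr_rest u : psi_dfr u = expR (u dfr) / (expR (u dfr) + cls_rest u).
Proof.
rewrite /psi_dfr big_ord_recr/=; congr (_ / _).
by rewrite -/(cls_sum u) -/(cls_max u) /cls_rest; ring.
Qed.

Lemma expR_dfr_logit (hK : (1 < K)%N) u :
  expR (dfr_logit u) = expR (u dfr) / cls_rest u.
Proof. by rewrite /dfr_logit expRB lnK// posrE cls_rest_gt0. Qed.

Lemma psi_dfrE (hK : (1 < K)%N) u :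
  psi_dfr u = expR (dfr_logit u) / (1 + expR (dfr_logit u)).
Proof.
rewrite psi_dfr_rest (expR_dfr_logit hK).
have := cls_rest_gt0 hK u; have := expR_gt0 (u dfr).
move: (expR _) (cls_rest u) => s D s0 D0.
by field; rewrite !gt_eqF//; lra.
Qed.

(** Exponential-family form: each log-loss is a log-partition function minus a term linear in the
    natural parameters, the class scores and [dfr_logit]. *)
Lemma LpsiE (hK : (1 < K)%N) u y m : Lpsi u y m =
  (ln (cls_sum u) - u (cls y)) +
  (ln (1 + expR (dfr_logit u)) - (m == y)%:R * dfr_logit u).
Proof.
rewrite /Lpsi (psi_dfrE hK) /psi_cls -/(cls_sum u).
have t0 := expR_gt0 (dfr_logit u).
rewrite ln_div ?posrE ?expR_gt0 ?(cls_sum_gt0 hK)// expRK.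
rewrite ln_div ?posrE ?expR_gt0//.
have -> : 1 - expR (dfr_logit u) / (1 + expR (dfr_logit u)) =
  (1 + expR (dfr_logit u))^-1 by field; rewrite gt_eqF//; lra.
rewrite lnV ?posrE ?expRK; last by lra.
by case: (m == y); rewrite /= ?mulr1n ?mulr0n; ring.
Qed.

Lemma Lpsi_ge0 (hK : (1 < K)%N) u y m : 0 <= Lpsi u y m.
Proof.
rewrite (LpsiE hK); apply: addr_ge0; rewrite subr_ge0.
  by rewrite -ler_expR lnK ?posrE ?(cls_sum_gt0 hK)// expR_le_cls_sum.
have t0 := expR_gt0 (dfr_logit u).
rewrite -ler_expR lnK ?posrE; last by lra.
by case: (m == y); rewrite /= ?mul1r ?mul0r ?expR0; lra.
Qed.

Lemma score_argmax (hK : (1 < K)%N) u y :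
  score u (Some y) <= score u (argmax_cls u).
Proof.
have [c -> hc] := argmax_cls_Some (ltnW hK) u.
by rewrite /= /psi_cls ler_pM2r ?invr_gt0 ?(cls_sum_gt0 hK)// ler_expR.
Qed.

(** The asymmetric denominator serves here. With [t], [x] the exponentials of the deferral score and
    the largest class score and [S] the class sum, [t/(t+S-x) >= x/S] amounts to [(t-x)(S-x) >= 0].
    As [S-x > 0], comparing probabilities is comparing scores. *)
Lemma score_phi (hK : (1 < K)%N) u f : score u f <= score u (phi u).
Proof.
have S0 := cls_sum_gt0 hK u; have D0 := cls_rest_gt0 hK u.
have t0 := expR_gt0 (u dfr).
rewrite phiE; case: ifPn => [/forallP h|].
  case: f => [y|//] /=; rewrite psi_dfr_rest /psi_cls -/(cls_sum u).
  rewrite ler_pdivrMr// mulrAC ler_pdivlMr; last by lra.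
  have := h y; rewrite -ltr_expR; have := cls_max_ge u y.
  have := expR_gt0 (u (cls y)); move: D0; rewrite /cls_rest.
  move: (expR _) (expR _) (cls_sum u) (cls_max u) t0 S0.
  by move=> t S e x *; nra.
rewrite negb_forall => /existsP[y]; rewrite -leNgt => ty.
case: f => [y'|]; first exact: score_argmax.
have [c -> hc] := argmax_cls_Some (ltnW hK) u.
have tc := le_trans ty (hc y).
rewrite /= psi_dfr_rest /psi_cls -/(cls_sum u).
rewrite ler_pdivrMr; last by lra.
rewrite mulrAC ler_pdivlMr//; move: D0 tc; rewrite -ler_expR.
rewrite /cls_rest (cls_max_arg hc).
move: (expR _) (expR _) (cls_sum u) t0 S0 (expR_gt0 (u (cls c))) => *; nra.
Qed.

(** * Exponential tilting of a score vector *)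

Implicit Type lam : R.

Definition pull lam f a (b : option 'I_K) : R :=
  lam * ((f == b)%:R - (a == b)%:R).

(** [unlift ord_max] reads a coordinate as a decision: [None] at the deferral coordinate, [Some y]
    at [cls y]. *)
Definition pre_tilt lam f a u (i : 'I_K.+1) : R := u i + pull lam f a (unlift ord_max i).

(* The correction of the deferral coordinate makes [dfr_logit] move by exactly
   [pull lam f a None], although [cls_rest] changes with the class scores. *)
Definition tilt lam f a u (i : 'I_K.+1) : R :=
  pre_tilt lam f a u i
  + (i == dfr)%:R * (ln (cls_rest (pre_tilt lam f a u)) - ln (cls_rest u)).

Lemma cls_lift y : cls y = lift ord_max y.
Proof. by apply: ord_inj; rewrite lift_max. Qed.

Lemma tilt_cls lam f a u y :
  tilt lam f a u (cls y) = u (cls y) + pull lam f a (Some y).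
Proof.
by rewrite /tilt /pre_tilt cls_lift liftK eq_sym (negbTE (neq_lift _ _)) mul0r addr0.
Qed.

Lemma dfr_logit_tilt lam f a u :
  dfr_logit (tilt lam f a u) = dfr_logit u + pull lam f a None.
Proof.
have restE : cls_rest (tilt lam f a u) = cls_rest (pre_tilt lam f a u).
  by rewrite /cls_rest /cls_sum /cls_max; congr (_ - _); apply: eq_bigr => y _;
    rewrite tilt_cls /pre_tilt cls_lift liftK.
rewrite /dfr_logit restE /tilt eqxx mul1r /pre_tilt unlift_none; ring.
Qed.

(** At most one of the two indicators is 1, so the exponential is affine in them; the tilted
    partition functions thus become explicit. *)
Lemma expR_pull lam f a b : f != a -> expR (pull lam f a b) =
  1 + (f == b)%:R * (expR lam - 1) + (a == b)%:R * (expR (- lam) - 1).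
Proof.
move=> fa; rewrite /pull; have [fb|_] := eqVneq f b.
  rewrite -fb [a == f]eq_sym (negbTE fa) subr0 mulr1.
  by rewrite mul1r mul0r addr0 addrC subrK.
have [ab|_] := eqVneq a b; last first.
  by rewrite subrr mulr0 expR0 !mul0r !addr0.
by rewrite sub0r mulrN1 mul0r mul1r addr0 addrC subrK.
Qed.

Lemma sum_indic_Some (f : option 'I_K) (F : 'I_K -> R) :
  \sum_(y < K) F y * (f == Some y)%:R = if f is Some y then F y else 0.
Proof.
case: f => [y|]; last by apply: big1 => y _; rewrite mulr0.
rewrite (bigD1 y)//= eqxx mulr1 big1 ?addr0// => i iy.
by case: eqVneq => [[yi]|_]; rewrite ?mulr0//; rewrite yi eqxx in iy.
Qed.

Lemma psi_cls_ge0 u y : 0 <= psi_cls u y.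
Proof.
by rewrite divr_ge0 ?expR_ge0// sumr_ge0// => i _; exact: expR_ge0.
Qed.

Lemma psi_cls_pair (hK : (1 < K)%N) u y c : y != c ->
  psi_cls u y + psi_cls u c <= 1.
Proof.
move=> yc; rewrite /psi_cls -/(cls_sum u) -mulrDl ler_pdivrMr ?cls_sum_gt0//.
rewrite mul1r /cls_sum (bigD1 y)//= (bigD1 c) 1?eq_sym//= addrA lerDl.
by rewrite sumr_ge0// => i _; exact: expR_ge0.
Qed.

Lemma psi_cls_le1 (hK : (1 < K)%N) u y : psi_cls u y <= 1.
Proof.
by rewrite /psi_cls ler_pdivrMr ?mul1r ?(cls_sum_gt0 hK)// expR_le_cls_sum.
Qed.

Lemma psi_dfr_itv (hK : (1 < K)%N) u : 0 <= psi_dfr u <= 1.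
Proof.
rewrite (psi_dfrE hK); have t0 := expR_gt0 (dfr_logit u).
by rewrite divr_ge0/= ?ler_pdivrMr; lra.
Qed.

(** The ratio of partition functions is the expectation of [expR (pull ..)] under [psi_cls]. *)
Lemma cls_sum_tilt (hK : (1 < K)%N) lam f a u : f != a ->
  cls_sum (tilt lam f a u) = cls_sum u *
   (1 + (if f is Some y then psi_cls u y else 0) * (expR lam - 1)
      + (if a is Some y then psi_cls u y else 0) * (expR (- lam) - 1)).
Proof.
move=> fa; have S0 := cls_sum_gt0 hK u.
rewrite -!sum_indic_Some !mulrDr mulr1 ![cls_sum u * (_ * _)]mulrA !mulr_sumr.
rewrite !mulr_suml -!big_split/=; apply: eq_bigr => y _.
rewrite tilt_cls expRD expR_pull// /psi_cls -/(cls_sum u).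
by field; rewrite gt_eqF.
Qed.

Lemma logit_tilt (hK : (1 < K)%N) lam f a u : f != a ->
  1 + expR (dfr_logit (tilt lam f a u)) = (1 + expR (dfr_logit u)) *
   (1 + (f == None)%:R * psi_dfr u * (expR lam - 1)
      + (a == None)%:R * psi_dfr u * (expR (- lam) - 1)).
Proof.
move=> fa; rewrite dfr_logit_tilt expRD expR_pull// (psi_dfrE hK).
have t0 := expR_gt0 (dfr_logit u).
by field; rewrite gt_eqF//; lra.
Qed.

Lemma partition_tilt (hK : (1 < K)%N) lam f a u :
  0 <= lam -> score u f <= score u a ->
  ln (cls_sum (tilt lam f a u)) + ln (1 + expR (dfr_logit (tilt lam f a u)))
  <= ln (cls_sum u) + ln (1 + expR (dfr_logit u)) + lam ^+ 2 / 2.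
Proof.
move=> lam0 fa.
have S0 v := cls_sum_gt0 hK v.
have t0 v : 0 < 1 + expR (dfr_logit v) by rewrite ltr_pDl ?expR_gt0.
rewrite -[lam ^+ 2 / 2]expRK -!lnM ?posrE ?mulr_gt0 ?expR_gt0//.
rewrite ler_ln ?posrE ?mulr_gt0 ?expR_gt0//.
(* If [f = a] the two pulls cancel and the partition functions do not change. *)
have [<-|nfa] := eqVneq f a.
  have -> : cls_sum (tilt lam f f u) = cls_sum u.
    apply: eq_bigr => y _.
    by rewrite tilt_cls /pull subrr mulr0 addr0.
  rewrite dfr_logit_tilt /pull subrr mulr0 addr0 ler_peMr//.
    by rewrite mulr_ge0 ?ltW.
  by rewrite -expR0 ler_expR divr_ge0 ?sqr_ge0.
rewrite (cls_sum_tilt hK)// (logit_tilt hK)// mulrACA ler_pM2l ?mulr_gt0//.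
apply: (@le_trans _ _ ((expR lam + expR (- lam)) / 2)); last first.
  by have := cosh_le_expR_half_sqr _ lam0; lra.
have EE : expR lam * expR (- lam) = 1 by rewrite -expRD subrr expR0.
have E1 : 1 <= expR lam by rewrite -expR0 ler_expR.
have E'0 := expR_gt0 (- lam).
have /andP[s0 s1] := psi_dfr_itv hK u.
have q0 := psi_cls_ge0 u; have q1 := psi_cls_le1 hK u.
(* Two distinct classes change only the class distribution, and the coin factor is 1. A class
   against deferral changes each of the two factors once. The score hypothesis supplies [p <= q]. *)
case: f fa nfa => [h|]; case: a => [c|] //= fa nfa;
  rewrite ?(mul0r, mul1r, addr0).
- by rewrite mulr1; apply: tilt_two_outcomes => //; apply: psi_cls_pair.
- exact: tilt_two_coins.
- by rewrite mulrC; exact: tilt_two_coins.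
Qed.

Lemma Lpsi_tilt (hK : (1 < K)%N) lam f a u y m :
  0 <= lam -> score u f <= score u a ->
  Lpsi (tilt lam f a u) y m + lam * loss01_defer a y m <=
  Lpsi u y m + lam * loss01_defer f y m + lam ^+ 2 / 2.
Proof.
move=> lam0 fa; have := partition_tilt hK lam0 fa.
rewrite !(LpsiE hK) tilt_cls dfr_logit_tilt.
(* The loss is 1 minus the indicators that the tilt adds to the linear terms of [LpsiE], so these
   terms change the surrogate by exactly [lam] times the loss of [f] minus that of [a]. *)
have lossE (b : option 'I_K) : loss01_defer b y m =
    1 - (b == Some y)%:R - (b == None)%:R * (m == y)%:R :> R.
  case: b => [c|] /=; last by rewrite subr0 mul1r; case: (m == y); rewrite /= ?subrr ?subr0.
  have -> : (Some c == Some y) = (c == y) by [].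
  by rewrite mul0r subr0; case: (c == y); rewrite /= ?subrr ?subr0.
rewrite !lossE /pull.
lra.
Qed.
End Scores.

(** * Measurability of finite-valued maps through their fibres *)

Section FiniteMeasurability.
Set Implicit Arguments.
Unset Strict Implicit.
Context {d : measure_display} {T : measurableType d}.

(** Gluing over the finite partition into fibres of [s]: it suffices to freeze the finite-valued
    argument. *)
Lemma measurable_fun_finmap {d' : measure_display} {U : measurableType d'}
    (I : finType) (s : T -> I) (F : I -> T -> U) :
  measurable_finmap s -> (forall i, measurable_fun setT (F i)) ->
  measurable_fun setT (fun x => F (s x) x).
Proof.
move=> ms mF _ B mB; rewrite setTI.
have -> : (fun x => F (s x) x) @^-1` B =
    \bigcup_(i in [set: I]) (s @^-1` [set i] `&` F i @^-1` B).
  apply/seteqP; split => [x Bx|x [i _ [<-]]//].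
  by exists (s x).
apply: fin_bigcup_measurable => [|i _]; first exact: finite_finset.
apply: measurableI; first exact: ms.
by rewrite -[X in measurable X]setTI; exact: mF.
Qed.

Lemma measurable_finmap_comp (I J : finType) (h : I -> J) (s : T -> I) :
  measurable_finmap s -> measurable_finmap (h \o s).
Proof.
move=> ms j.
have -> : (h \o s) @^-1` [set j] =
    \bigcup_(i in [set i | h i = j]) s @^-1` [set i].
  apply/seteqP; split => [x hx|x [i /= <- <-]//].
  by exists (s x).
apply: fin_bigcup_measurable => [|i _]; [exact: finite_finset|exact: ms].
Qed.

Lemma measurable_finmap_ffun (I J : finType) (s : I -> T -> J) :
  (forall i, measurable_finmap (s i)) ->
  measurable_finmap (fun x => [ffun i => s i x]).
Proof.
move=> ms t.
have -> : (fun x => [ffun i => s i x]) @^-1` [set t] =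
    \bigcap_(i in [set: I]) s i @^-1` [set t i].
  apply/seteqP; split => [x /= <- i _|x h]; first by rewrite /= ffunE.
  by apply/ffunP => i; rewrite ffunE; exact: h.
apply: fin_bigcap_measurable => [|i _]; [exact: finite_finset|exact: ms].
Qed.

End FiniteMeasurability.

(** * Measurability of the decisions and of the surrogate loss *)

Section ScorerMeasurability.
Set Implicit Arguments.
Unset Strict Implicit.
Context {R : realType} {K : nat}.
Context {d : measure_display} {T : measurableType d}.
Variables (g : 'I_K.+1 -> T -> R) (mg : measurable_scorer g).

(** The order pattern of the scores takes values in a finite type and determines both [argmax_cls]
    and [phi]. *)
Definition comparisons (x : T) : {ffun 'I_K.+1 * 'I_K.+1 -> bool} :=
  [ffun p => g p.1 x <= g p.2 x].

Lemma measurable_comparisons : measurable_finmap comparisons.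
Proof.
apply: measurable_finmap_ffun => p b.
rewrite -[X in measurable X]setTI.
exact: (measurable_fun_ler (mg p.1) (mg p.2)).
Qed.

Definition argmax_of (r : {ffun 'I_K.+1 * 'I_K.+1 -> bool}) : option 'I_K :=
  [pick i : 'I_K | [forall j : 'I_K, r (cls j, cls i)]].

Lemma argmax_comparisons :
  (fun x => argmax_cls (fun i => g i x)) = argmax_of \o comparisons.
Proof.
apply/funext => x /=; apply: eq_pick => i /=.
by apply: eq_forallb => j; rewrite ffunE.
Qed.

Lemma measurable_argmax :
  measurable_finmap (fun x => argmax_cls (fun i => g i x)).
Proof.
rewrite argmax_comparisons; apply: measurable_finmap_comp.
exact: measurable_comparisons.
Qed.

Lemma measurable_phi :
  measurable_finmap (fun x => phi (fun i => g i x)).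
Proof.
have -> : (fun x => phi (fun i => g i x)) =
    (fun r : {ffun 'I_K.+1 * 'I_K.+1 -> bool} =>
      if [forall y : 'I_K, ~~ r (dfr, cls y)] then None
      else argmax_of r) \o comparisons.
  apply/funext => x; rewrite phiE/= -[argmax_of _]/((argmax_of \o comparisons) x).
  rewrite -argmax_comparisons; congr (if _ then _ else _).
  by apply: eq_forallb => y; rewrite ffunE/= ltNge.
exact/measurable_finmap_comp/measurable_comparisons.
Qed.

Lemma measurable_expR_comp (f : T -> R) :
  measurable_fun setT f -> measurable_fun setT (fun x => expR (f x)).
Proof. by move=> mf; apply: measurableT_comp => //; exact: measurable_expR. Qed.

Lemma measurable_ln_comp (f : T -> R) :
  measurable_fun setT f -> measurable_fun setT (fun x => ln (f x)).
Proof. by move=> mf; apply: measurableT_comp => //; exact: measurable_ln. Qed.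

Lemma measurable_bigmaxr (I : Type) (s : seq I) (h : I -> T -> R) :
  (forall i, measurable_fun setT (h i)) ->
  measurable_fun setT (fun x => \big[Num.max/0]_(i <- s) h i x).
Proof.
move=> mh; elim: s => [|i s IHs].
  by under eq_fun do rewrite big_nil; exact: measurable_cst.
by under eq_fun do rewrite big_cons; exact: measurable_maxr.
Qed.

Lemma measurable_cls_sum :
  measurable_fun setT (fun x => cls_sum (fun i => g i x)).
Proof. by apply: measurable_sum => y; exact: measurable_expR_comp. Qed.

Lemma measurable_cls_rest :
  measurable_fun setT (fun x => cls_rest (fun i => g i x)).
Proof.
apply: measurable_funB; first exact: measurable_cls_sum.
by apply: measurable_bigmaxr => y; exact: measurable_expR_comp.
Qed.

Lemma measurable_dfr_logit :
  measurable_fun setT (fun x => dfr_logit (fun i => g i x)).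
Proof.
by apply: measurable_funB => //; exact/measurable_ln_comp/measurable_cls_rest.
Qed.

Lemma measurable_Lpsi (hK : (1 < K)%N) (y m : 'I_K) :
  measurable_fun setT (fun x => Lpsi (fun i => g i x) y m).
Proof.
under eq_fun do rewrite (LpsiE hK).
apply: measurable_funD; apply: measurable_funB => //.
- exact/measurable_ln_comp/measurable_cls_sum.
- apply/measurable_ln_comp/measurable_funD => //.
  exact/measurable_expR_comp/measurable_dfr_logit.
- by apply: measurable_funM => //; exact: measurable_dfr_logit.
Qed.

End ScorerMeasurability.

Lemma measurable_tilt {R : realType} {K : nat} {d : measure_display}
    {T : measurableType d} (g : 'I_K.+1 -> T -> R) (lam : R)
    (f a : T -> option 'I_K) :
  measurable_scorer g -> measurable_finmap f -> measurable_finmap a ->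
  measurable_scorer (fun i x => tilt lam (f x) (a x) (fun j => g j x) i).
Proof.
move=> mg mf ma i.
apply: (@measurable_fun_finmap _ _ _ _ _ f
  (fun b x => tilt lam b (a x) (fun j => g j x) i)) => // b.
apply: (@measurable_fun_finmap _ _ _ _ _ a
  (fun c x => tilt lam b c (fun j => g j x) i)) => // c.
have mpre j : measurable_fun setT (fun x => pre_tilt lam b c (fun j => g j x) j).
  exact: measurable_funD.
apply: measurable_funD => //; apply: measurable_funM => //.
apply: measurable_funB; apply: measurable_ln_comp.
  exact: (@measurable_cls_rest _ _ _ _
    (fun j x => pre_tilt lam b c (fun j => g j x) j)).
exact: measurable_cls_rest.
Qed.

(** * Integration, and the regret bound for an arbitrary competitor *)

Section Regret.
Set Implicit Arguments.
Unset Strict Implicit.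
Local Open Scope ereal_scope.
Context {R : realType} {K : nat} (hK : (1 < K)%N).
Context {d : measure_display} {Omega : measurableType d}
  (P : probability Omega R).
Context {dX : measure_display} {Xs : measurableType dX}.
Variables (X : Omega -> Xs) (Y M : Omega -> 'I_K).
Hypotheses (mX : measurable_fun setT X) (mY : measurable_finmap Y)
  (mM : measurable_finmap M).
Implicit Types (g : 'I_K.+1 -> Xs -> R) (a f : Xs -> option 'I_K).

Lemma measurable_finmap_X (I : finType) (h : Xs -> I) :
  measurable_finmap h -> measurable_finmap (h \o X).
Proof.
by move=> mh i; rewrite -[Z in measurable Z]setTI; exact: (mX measurableT (mh i)).
Qed.

Lemma integral_cst_probability (r : R) : \int[P]_w cst r%:E w = r%:E.
Proof.
rewrite integral_cst// -[RHS]mule1; congr (_ * _); exact: probability_setT.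
Qed.

Lemma measurable_risk_integrand (F : Omega -> 'I_K -> 'I_K -> R) :
  (forall y m, measurable_fun setT (fun w => F w y m)) ->
  measurable_fun setT (fun w => (F w (Y w) (M w))%:E).
Proof.
move=> mF; apply/measurable_EFinP.
apply: (@measurable_fun_finmap _ _ _ _ _ Y (fun y w => F w y (M w))) => // y.
exact: (@measurable_fun_finmap _ _ _ _ _ M (fun m w => F w y m)).
Qed.

Lemma measurable_loss a : measurable_finmap a ->
  measurable_fun setT (fun w => (loss01_defer (a (X w)) (Y w) (M w) : R)%:E).
Proof.
move=> ma; apply: (@measurable_risk_integrand
  (fun w y m => loss01_defer (a (X w)) y m)) => y m.
apply: (@measurable_fun_finmap _ _ _ _ _ (a \o X)
  (fun b _ => loss01_defer b y m)); first exact: measurable_finmap_X.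
by move=> b; exact: measurable_cst.
Qed.

Lemma measurable_Lpsi_integrand g : measurable_scorer g ->
  measurable_fun setT (fun w => (Lpsi (fun i => g i (X w)) (Y w) (M w))%:E).
Proof.
move=> mg; apply: (@measurable_risk_integrand
  (fun w y m => Lpsi (fun i => g i (X w)) y m)) => y m.
apply: (@measurable_Lpsi _ _ _ _ (fun i w => g i (X w))) => // i.
exact: measurableT_comp (mg i) mX.
Qed.

Lemma loss_ge0 (b : option 'I_K) y m : (0 <= loss01_defer b y m :> R)%R.
Proof. by case: b => [c|]; exact: ler0n. Qed.

Lemma loss_le1 (b : option 'I_K) y m : (loss01_defer b y m <= 1 :> R)%R.
Proof. by case: b => [c|]; rewrite /= lern1 leq_b1. Qed.

Lemma risk_defer_fin_num a : measurable_finmap a ->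
  risk01_defer_of P X Y M a \is a fin_num.
Proof.
move=> ma; rewrite ge0_fin_numE; last first.
  by apply: integral_ge0 => w _; rewrite lee_fin loss_ge0.
apply: (@le_lt_trans _ _ (\int[P]_w (cst 1 w))); last first.
  by rewrite integral_cst_probability ltry.
apply: ge0_le_integral => //.
- by move=> w _; rewrite lee_fin loss_ge0.
- exact: measurable_loss.
- by move=> w _; rewrite lee_fin loss_le1.
Qed.

Lemma risk_L_ge0 g : 0 <= risk_L P X Y M g.
Proof. by apply: integral_ge0 => w _; rewrite lee_fin Lpsi_ge0. Qed.

Lemma risk_L_star_ge0 : 0 <= risk_L_star P X Y M.
Proof. by apply: le_ereal_inf_tmp => _ [g _ <-]; exact: risk_L_ge0. Qed.

Lemma risk_L_star_le g : measurable_scorer g ->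
  risk_L_star P X Y M <= risk_L P X Y M g.
Proof. by move=> mg; apply: ereal_inf_lbound; exists g. Qed.

Lemma risk_L_star_fin_num : risk_L_star P X Y M \is a fin_num.
Proof.
rewrite ge0_fin_numE ?risk_L_star_ge0//.
(* The zero scorer has bounded loss: the outcomes enter only through [(m == y)%:R * dfr_logit u],
   whence the absolute value in [c]. *)
pose u : 'I_K.+1 -> R := fun=> 0%R.
have mu : measurable_scorer (fun i (_ : Xs) => u i).
  by move=> i; exact: measurable_cst.
apply: (le_lt_trans (risk_L_star_le mu)).
pose c := (ln (cls_sum u) + (ln (1 + expR (dfr_logit u)) + `|dfr_logit u|))%R.
apply: (@le_lt_trans _ _ (\int[P]_w cst c%:E w)).
  apply: ge0_le_integral => //.
  - by move=> w _; rewrite lee_fin Lpsi_ge0.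
  - exact: (measurable_Lpsi_integrand mu).
  move=> w _; rewrite lee_fin (LpsiE hK) /c.
  rewrite (_ : u (cls (Y w)) = 0%R)// subr0 lerD2l lerD2l.
  rewrite -mulNr; apply: le_trans (ler_norm _) _; rewrite normrM normrN normr_nat.
  by rewrite ler_piMl// lern1 leq_b1.
by rewrite integral_cst_probability ltry.
Qed.

(** The integral of [Lpsi_tilt]. Keeping only nonnegative summands on both sides allows additivity
    of the integral even when the surrogate risk of [g] is infinite. *)
Lemma risk_L_tilt (lam : R) g a f : (0 <= lam)%R ->
  measurable_scorer g -> measurable_finmap a -> measurable_finmap f ->
  (forall x, score (fun i => g i x) (f x) <= score (fun i => g i x) (a x))%R ->
  risk_L_star P X Y M + lam%:E * risk01_defer_of P X Y M a <=
  risk_L P X Y M g + lam%:E * risk01_defer_of P X Y M f + (lam ^+ 2 / 2)%:E.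
Proof.
move=> lam0 mg ma mf gfa.
have [g' mg' Lg'] : exists2 g', measurable_scorer g' & forall x y m,
    (Lpsi (fun i => g' i x) y m + lam * loss01_defer (a x) y m <=
     Lpsi (fun i => g i x) y m + lam * loss01_defer (f x) y m + lam ^+ 2 / 2)%R.
  exists (fun i x => tilt lam (f x) (a x) (fun j => g j x) i).
    exact: measurable_tilt.
  by move=> x y m; exact: Lpsi_tilt.
have lam2 : (0 <= lam ^+ 2 / 2)%R by rewrite divr_ge0 ?sqr_ge0.
have loss0 b : forall w, [set: Omega] w ->
    0 <= (loss01_defer (b (X w)) (Y w) (M w) : R)%:E.
  by move=> w _; rewrite lee_fin loss_ge0.
have L0 h : forall w, [set: Omega] w ->
    0 <= (Lpsi (fun i => h i (X w)) (Y w) (M w) : R)%:E.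
  by move=> w _; rewrite lee_fin Lpsi_ge0.
have mlam b : measurable_finmap b -> measurable_fun setT
    (fun w => lam%:E * (loss01_defer (b (X w)) (Y w) (M w) : R)%:E).
  by move=> mb; apply: measurable_funeM; exact: measurable_loss.
have lamloss0 b : forall w, [set: Omega] w ->
    0 <= lam%:E * (loss01_defer (b (X w)) (Y w) (M w) : R)%:E.
  by move=> w _; rewrite mule_ge0 ?lee_fin ?loss_ge0.
have addE h b : measurable_scorer h -> measurable_finmap b ->
    risk_L P X Y M h + lam%:E * risk01_defer_of P X Y M b =
    \int[P]_w ((Lpsi (fun i => h i (X w)) (Y w) (M w))%:E +
               lam%:E * (loss01_defer (b (X w)) (Y w) (M w))%:E).
  move=> mh mb; rewrite (ge0_integralD P measurableT (L0 h)
    (measurable_Lpsi_integrand mh) (lamloss0 b) (mlam b mb)).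
  by rewrite (ge0_integralZl P measurableT (measurable_loss mb) (loss0 b)).
have sum0 h b : forall w, [set: Omega] w ->
    0 <= (Lpsi (fun i => h i (X w)) (Y w) (M w) : R)%:E +
         lam%:E * (loss01_defer (b (X w)) (Y w) (M w))%:E.
  by move=> w Tw; rewrite adde_ge0 ?L0 ?lamloss0.
have msum h b : measurable_scorer h -> measurable_finmap b ->
    measurable_fun setT (fun w =>
      (Lpsi (fun i => h i (X w)) (Y w) (M w) : R)%:E +
      lam%:E * (loss01_defer (b (X w)) (Y w) (M w))%:E).
  move=> mh mb; apply: emeasurable_funD; last exact: mlam.
  exact: measurable_Lpsi_integrand.
apply: (le_trans (leeD2r _ (risk_L_star_le mg'))).
rewrite [leLHS](addE _ _ mg' ma) [Z in Z + (_ / _)%:E](addE _ _ mg mf).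
rewrite -(integral_cst_probability (lam ^+ 2 / 2)).
rewrite -(ge0_integralD P measurableT (sum0 g f) (msum g f mg mf))//.
apply: (ge0_le_integral P measurableT (sum0 _ a) (msum _ a mg' ma)).
- by apply: emeasurable_funD => //; exact: msum.
- by move=> w _; rewrite -!EFinM -!EFinD lee_fin; exact: Lg'.
Qed.

(* [risk_L_tilt] is used with [lam] equal to the regret itself, the value
   minimizing [lam ^+ 2 / 2 - lam * regret]. *)
Lemma regret_le_sqrt g a f :
  measurable_scorer g -> measurable_finmap a -> measurable_finmap f ->
  (forall x, score (fun i => g i x) (f x) <= score (fun i => g i x) (a x))%R ->
  risk01_defer_of P X Y M a - risk01_defer_of P X Y M f <=
  sqrte (2%:E * (risk_L P X Y M g - risk_L_star P X Y M)).
Proof.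
move=> mg ma mf gfa.
have key lam lam0 := @risk_L_tilt lam g a f lam0 mg ma mf gfa.
have := risk_L_star_le mg; have := risk_L_star_fin_num; have := risk_L_ge0 g.
have := risk_defer_fin_num ma; have := risk_defer_fin_num mf.
move: (risk01_defer_of _ _ _ _ a) (risk01_defer_of _ _ _ _ f) key.
move: (risk_L P X Y M g) (risk_L_star P X Y M).
(* Besides the finite case only [L = +oo] survives, where the right-hand side is [+oo]. *)
move=> [L||] [S||]// [ra||]// [rf||]// key _ _ _ _ _; last first.
  by rewrite addye// mulry gtr0_sg// mul1e leey.
have [arf|far] := leP ra rf.
  by apply: le_trans (sqrte_ge0 _); rewrite lee_fin subr_le0.
have D0 : (0 <= ra - rf)%R by rewrite subr_ge0 ltW.
have := key _ D0; rewrite -!EFinM -!EFinD lee_fin => {}key.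
(* With [D = ra - rf], [key] says [S + D ra <= L + D rf + D^2/2], that is [D^2 <= 2 (L - S)]. *)
rewrite /sqrte lee_fin -[leLHS]ger0_norm// -sqrtr_sqr ler_wsqrtr//.
nra.
Qed.

(** The infimum need not be attained, so the bound is applied to each competitor. The set [C] is
    left abstract to cover both the classification and the deferral risk. *)
Lemma regret_inf_le_sqrt g a (C : set \bar R) :
  measurable_scorer g -> measurable_finmap a ->
  (forall r, C r -> exists2 f, measurable_finmap f &
    r = risk01_defer_of P X Y M f /\
    forall x, (score (fun i => g i x) (f x) <= score (fun i => g i x) (a x))%R) ->
  risk01_defer_of P X Y M a - ereal_inf C <=
  sqrte (2%:E * (risk_L P X Y M g - risk_L_star P X Y M)).
Proof.
move=> mg ma hC.
have hS r : C r -> risk01_defer_of P X Y M a - r <=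
    sqrte (2%:E * (risk_L P X Y M g - risk_L_star P X Y M)).
  by move=> /hC[f mf [-> gfa]]; exact: regret_le_sqrt.
have := sqrte_ge0 (2%:E * (risk_L P X Y M g - risk_L_star P X Y M)).
move: (sqrte _) hS => [S||]// hS _; last by rewrite leey.
rewrite lee_subel_addl// addeC -leeBlDl//; apply: le_ereal_inf_tmp => r Cr.
by rewrite leeBlDl// addeC -lee_subel_addl//; exact: hS.
Qed.

(** Without deferral the 0-1-deferral loss is the misclassification indicator, so the classification
    regret is a deferral regret among rules that never defer. *)
Lemma risk01_as_defer a : measurable_finmap a -> (forall x, a x != None) ->
  P [set w | a (X w) != Some (Y w)] = risk01_defer_of P X Y M a.
Proof.
move=> ma aN; rewrite /risk01_defer_of.
set A := [set w | _].
have mA : measurable A.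
  rewrite (_ : A = ~` ((fun w => a (X w) == Some (Y w)) @^-1` [set true])).
    apply: measurableC; rewrite -[X in measurable X]setTI.
    apply: (@measurable_fun_finmap _ _ _ _ _ Y (fun y w => a (X w) == Some y)) => // y.
    apply: (@measurable_fun_finmap _ _ _ _ _ (a \o X) (fun b _ => b == Some y)).
      exact: measurable_finmap_X.
    by move=> b; exact: measurable_cst.
  by apply/seteqP; split => w /= /negP.
rewrite -[A in LHS]setIT -integral_indic//; apply: eq_integral => w _.
rewrite indicE; congr (_%:E).
case E : (a (X w)) (aN (X w)) => [c|]//= _.
by congr ((nat_of_bool _)%:R); apply/idP/idP; rewrite inE /A/= E.
Qed.
End Regret.

Local Open Scope ereal_scope.

Theorem theorem3 (R : realType) (K : nat) (hK : (1 < K)%N)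
  (d : measure_display) (Omega : measurableType d) (P : probability Omega R)
  (dX : measure_display) (Xs : measurableType dX)
  (X : Omega -> Xs) (Y M : Omega -> 'I_K)
  (mX : measurable_fun setT X)
  (mY : forall k : 'I_K, measurable (Y @^-1` [set k]))
  (mM : forall k : 'I_K, measurable (M @^-1` [set k]))
  (g : 'I_K.+1 -> Xs -> R) (mg : measurable_scorer g) :
  maxe (risk01 P X Y g - risk01_star P X Y)
       (risk01_defer P X Y M g - risk01_defer_star P X Y M)
  <= sqrte (2%:E * (risk_L P X Y M g - risk_L_star P X Y M)).
Proof.
have aN x : argmax_cls (fun i => g i x) != None.
  by have [c -> _] := argmax_cls_Some (ltnW hK) (fun i => g i x).
rewrite ge_max; apply/andP; split.
- rewrite /risk01 (risk01_as_defer P M mX mY (measurable_argmax mg) aN).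
  apply: regret_inf_le_sqrt => //; first exact: measurable_argmax.
  (* Competitors are classifiers read as rules that never defer; among these [argmax_cls] has the
     largest score. *)
  move=> _ [h mh <-]; exists (Some \o h); first exact: measurable_finmap_comp.
  split; last by move=> x; exact: score_argmax.
  by rewrite -risk01_as_defer//; exact: measurable_finmap_comp.
- apply: regret_inf_le_sqrt => //; first exact: measurable_phi.
  by move=> _ [f mf <-]; exists f => //; split=> // x; exact: score_phi.
Qed.
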